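(* Let $X$ be an infinite-dimensional Fréchet space over $\mathbb{K}\in\{\mathbb{R},\mathbb{C}\}$, let $(p_j)_{j\in\mathbb{N}}$ be a separating increasing sequence of seminorms inducing the topology of $X$, let $d(x,y)=\sum_{j=1}^\infty 2^{-j}\min(1,p_j(x-y))$, and let $T\colon X\to X$ be a continuous linear operator. Then the following assertions are equivalent: (1) $T$ admits a dense set of distributionally semi-irregular vectors of type $1$; (2) $T$ admits a residual set of distributionally $m$-irregular vectors of type $1$ for some $m\in\mathbb{N}$; (3) there exists $m\in\mathbb{N}$ such that for every sequence $(O_j)_{j\in\mathbb{N}}$ of nonempty open subsets of $X$, there exists a sequence $(K_j)_{j\in\mathbb{N}}$ of Cantor sets with $K_j\subset O_j$ such that $\bigcup_{j=1}^\infty K_j$ is distributionally $m$-extremely scrambled of type $1$; (4) the distributionally proximal relation of $T$ is dense in $X\times X$ and $T$ is distributionally sensitive.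
   Context: $\mathbb{N}$ is the set of positive integers and $\mathbf 0$ is the zero vector of $X$. For $A\subset\mathbb{N}$, $\overline{\mathrm{dens}}(A)=\limsup_{n\to\infty}\frac{\mathrm{card}(A\cap[1,n])}{n}$. A set is residual if it contains a dense $G_\delta$ subset. A Cantor set is a subset homeomorphic to the Cantor ternary set. A vector $x\in X$ is distributionally semi-irregular of type $1$ for $T$ if there exists $A\subset\mathbb{N}$ with $\overline{\mathrm{dens}}(A)=1$ such that $\lim_{A\ni n\to\infty}T^nx=\mathbf 0$ and there exists $B\subset\mathbb{N}$ with $\overline{\mathrm{dens}}(B)=1$ such that $\liminf_{B\ni n\to\infty}d(T^nx,\mathbf 0)>0$. For $m\in\mathbb{N}$, $x$ is distributionally $m$-irregular of type $1$ if there exists $A\subset\mathbb{N}$ with $\overline{\mathrm{dens}}(A)=1$ such that $\lim_{A\ni n\to\infty}T^nx=\mathbf 0$ and there exists $B\subset\mathbb{N}$ with $\overline{\mathrm{dens}}(B)=1$ such that $\lim_{B\ni n\to\infty}p_m(T^nx)=\infty$. A pair $(x,y)\in X\times X$ is distributionally proximal if for every $\varepsilon>0$, $\overline{\mathrm{dens}}(\{n\in\mathbb{N}:d(T^nx,T^ny)<\varepsilon\})=1$; the distributionally proximal relation is the set of all such pairs. For $m\in\mathbb{N}$, a pair $(x,y)$ is distributionally $m$-extremely chaotic of type $1$ if it is distributionally proximal and for any $M>0$, $\overline{\mathrm{dens}}(\{n\in\mathbb{N}:p_m(T^nx-T^ny)>M\})=1$. A set $K\subset X$ is distributionally $m$-extremely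 scrambled of type $1$ if any two distinct points of $K$ form such a pair. $T$ is distributionally sensitive if there exists $\delta>0$ such that for every $x\in X$ and $\varepsilon>0$ there exists $y\in X$ with $d(x,y)<\varepsilon$ such that $\overline{\mathrm{dens}}(\{n\in\mathbb{N}:d(T^nx,T^ny)>\delta\})=1$. *)

(* Defs.v *)
From mathcomp Require Import all_boot all_order all_algebra.
From mathcomp Require Import all_classical all_reals all_analysis.
From mathcomp Require Import borel_hierarchy complex.

Set Implicit Arguments.
Unset Strict Implicit.
Unset Printing Implicit Defensive.

Import Order.TTheory GRing.Theory Num.Theory.
Import numFieldNormedType.Exports.

Local Open Scope classical_set_scope.
Local Open Scope ring_scope.

Inductive scalar_kind := RealScalars | ComplexScalars.

Definition scalar_field (R : realType) (k : scalar_kind) : numFieldType :=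
  match k with
  | RealScalars => R
  | ComplexScalars => complex R
  end.

(* MathComp's norm on [complex R] takes values in [complex R]; seminorms are
   real-valued, hence the real part. *)
Definition scalar_abs (R : realType) (k : scalar_kind) : scalar_field R k -> R :=
  match k with
  | RealScalars => fun a : R => `|a|
  | ComplexScalars => fun a : complex R => complex.Re `|a|
  end.

Definition seminorm (R : realType) (k : scalar_kind)
    (X : lmodType (scalar_field R k)) (q : X -> R) : Prop :=
  [/\ forall x, 0 <= q x,
      forall x y, q (x + y) <= q x + q y
    & forall a x, q (a *: x) = scalar_abs a * q x].

(* The seminorms are indexed from 0: [p j] stands for p_(j+1), whose weight is
   2^-(j+1). *)
Definition seminorm_dist (R : realType) (X : zmodType) (p : nat -> X -> R)
    (x y : X) : R :=
  limn (series (fun j => 2^-1 ^+ j.+1 * Num.min 1 (p j (x - y)))).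

(* The uniform structure carried by a [tvsType] is not required to be the
   translation-invariant one, so completeness is stated for the metric.  Since
   the seminorms increase, the balls of single seminorms form a neighbourhood
   base of the topology they induce. *)
Record frechet (R : realType) (k : scalar_kind) (X : tvsType (scalar_field R k))
    (p : nat -> X -> R) : Prop := {
  frechet_seminorm : forall j, seminorm (p j) ;
  frechet_separating : forall x, (forall j, p j x = 0) -> x = 0 ;
  frechet_increasing : forall i j x, (i <= j)%N -> p i x <= p j x ;
  frechet_topology : forall (x : X) (U : set X), nbhs x U <->
    exists j, exists2 e : R, 0 < e & [set y | p j (y - x) < e] `<=` U ;
  frechet_complete : forall u : nat -> X,
    (forall e : R, 0 < e -> exists N, forall m n, (N <= m)%N -> (N <= n)%N ->
       seminorm_dist p (u m) (u n) < e) ->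
    exists l : X, u @ \oo --> l
}.

Definition infinite_dimensional (K : numFieldType) (X : lmodType K) : Prop :=
  ~ exists (n : nat) (e : 'I_n -> X),
      forall x, exists c : 'I_n -> K, x = \sum_i c i *: e i.

(* The positive integers being the index set, 0 is never counted. *)
Definition upper_density (R : realType) (A : set nat) : \bar R :=
  limn_esup (fun n => ((count (mem A) (iota 1 n))%:R / n%:R : R)%:E).

Definition residual (X : topologicalType) (S : set X) : Prop :=
  exists G : set X, [/\ Gdelta G, dense G & G `<=` S].

(* Reals of [0, 1] having a ternary expansion with digits 0 and 2 only. *)
Definition cantor_ternary_set (R : realType) : set R :=
  [set x : R | exists a : nat -> bool,
    x = limn (series (fun n => (2 * a n)%:R * (3^-1 : R) ^+ n.+1))].

Definition homeomorphic_sets (S T : topologicalType) (A : set S) (B : set T) :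
    Prop :=
  exists (f : S -> T) (g : T -> S),
    [/\ {within A, continuous f}, {within B, continuous g},
        forall x, A x -> B (f x) /\ g (f x) = x
      & forall y, B y -> A (g y) /\ f (g y) = y].

Definition cantor_set (R : realType) (X : topologicalType) (K : set X) : Prop :=
  homeomorphic_sets (@cantor_ternary_set R) K.

Section distributional_chaos.
Context {R : realType} {k : scalar_kind} {X : tvsType (scalar_field R k)}.
Variables (p : nat -> X -> R) (T : X -> X).

Local Notation d := (seminorm_dist p).

Definition distr_semi_irregular1 (x : X) : Prop :=
  (exists2 A : set nat, upper_density R A = 1%E &
     iter n T x @[n --> within A \oo] --> (0 : X)) /\
  (exists2 B : set nat, upper_density R B = 1%E &
     (0 < limf_einf (fun n => (d (iter n T x) 0)%:E) (within B \oo))%E).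

Definition distr_irregular1 (m : nat) (x : X) : Prop :=
  (exists2 A : set nat, upper_density R A = 1%E &
     iter n T x @[n --> within A \oo] --> (0 : X)) /\
  (exists2 B : set nat, upper_density R B = 1%E &
     p m (iter n T x) @[n --> within B \oo] --> +oo).

Definition distr_proximal : set (X * X) :=
  [set xy | forall e : R, 0 < e ->
    upper_density R [set n | d (iter n T xy.1) (iter n T xy.2) < e] = 1%E].

Definition distr_extremely_chaotic1 (m : nat) : set (X * X) :=
  [set xy | distr_proximal xy /\ forall M : R, 0 < M ->
    upper_density R [set n | M < p m (iter n T xy.1 - iter n T xy.2)] = 1%E].

Definition distr_extremely_scrambled1 (m : nat) (K : set X) : Prop :=
  forall x y, K x -> K y -> x <> y -> distr_extremely_chaotic1 m (x, y).

Definition distr_sensitive : Prop :=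
  exists2 delta : R, 0 < delta & forall (x : X) (e : R), 0 < e ->
    exists2 y : X, d x y < e &
      upper_density R [set n | delta < d (iter n T x) (iter n T y)] = 1%E.

End distributional_chaos.

(* Main.v *)
Require Import Defs.
From mathcomp Require Import all_boot all_order all_algebra.
From mathcomp Require Import all_classical all_reals all_analysis.
From mathcomp Require Import borel_hierarchy complex zify lra ring.

Set Implicit Arguments.
Unset Strict Implicit.
Unset Printing Implicit Defensive.

Import Order.TTheory GRing.Theory Num.Theory.
Import numFieldNormedType.Exports.

Local Open Scope classical_set_scope.
Local Open Scope ring_scope.

(** By linearity every condition on a pair [(x, y)] is a condition on the orbit
of [x - y]. Two sets of vectors carry the whole theorem: those with a null
orbit, which is arbitrarily small on sets of times of upper density one, and
those with an [m]-unbounded orbit, on which [p m] exceeds every bound on such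
sets. A vector is distributionally [m]-irregular iff it is in both
([irregularP]), and a pair is distributionally [m]-extremely chaotic iff its
difference is in both ([extremely_chaoticP]).

Upper density one asks only for infinitely many good initial segments, so each
of the two sets is a countable intersection of open sets, and is comeager as
soon as these open sets are dense ([comeager_full]). Null orbits are dense when
semi-irregular vectors are, and also when the proximal relation is, since the
difference of a proximal pair has a null orbit. For unbounded orbits density
follows from [expanding_at_zero m]: a constant [eta > 0] such that arbitrarily
small [z] have [p m (T^n z) > eta] with upper density one
([comeager_unbounded_orbit]). Rescaling [z] replaces [eta] by any bound while
[z] remains small; then among the points [x + t z], [t < L], at most one can be
small at a time where [T^n z] is large, so some [t] is bad for a proportion of
about [1/L] of the times at most.

Sensitivity at the origin gives such a [z] directly. So does a single
semi-irregular vector [x]: its orbit comes back close to the origin, and the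
points of that orbit inherit the lower bound of [x], because upper density one
is invariant under shifts ([semi_irregular_expanding]). Hence the first and the
last assertions both make the [m]-irregular vectors comeager, so residual and
dense by Baire; and irregular vectors are semi-irregular.

For the scrambled sets, let [G] be the comeager set of [m]-irregular vectors.
One picks a sequence [v] such that every finite combination of the [v l] with
coefficients in [{-1, 0, 1}], not all zero, lies in [G]; this is possible since
[G - d] and [d - G] are comeager for each of the finitely many combinations [d]
already formed. The [v (2 * j)] are put in the prescribed open sets, and the [v
l] with odd [l] are taken so small that the infinite combinations also stay in
[G]. The sets [K j] of all sums of [v (2 * j)] and of some [v l], [l] odd and
larger than [2 * j], are Cantor sets, and differences of distinct points of
their union lie in [G] ([linear_mycielski]).

Conversely, scrambled Cantor sets in arbitrary open sets make the proximal
relation dense, and two points of such a set in a small ball around the origin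
have a small difference with an unbounded orbit, which can be added to any
vector to witness sensitivity. *)

(** * Sets of upper density one *)

(** Counting the times outside of [A], rather than inside, makes the estimates
monotone in [A] and free of subtraction. *)
Definition misses (A : set nat) (n : nat) : nat :=
  count (fun i => i \notin A) (iota 1 n).

(** Upper density one in natural numbers: some arbitrarily long segments [[1,
n]] are missed in a proportion less than [1/k], for every [k] ([fullP]). *)
Definition full (A : set nat) : Prop :=
  forall k N : nat, exists2 n, (N <= n)%N & (k * misses A n < n)%N.

Lemma misses_le (A : set nat) n : (misses A n <= n)%N.
Proof. by rewrite -[leqRHS](size_iota 1) count_size. Qed.

Lemma misses_mono (A B : set nat) n :
  (forall i, (0 < i <= n)%N -> A i -> B i) -> (misses B n <= misses A n)%N.
Proof.
move=> AB; rewrite /misses -!size_filter -!sum1_size !big_filter.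
rewrite big_seq_cond [leqRHS]big_seq_cond.
rewrite big_mkcond [leqRHS]big_mkcond leq_sum// => i _.
rewrite mem_iota; case: ifPn => // /andP[ri iB]; rewrite ifT//.
rewrite ri /=; apply: contra iB; rewrite !inE; apply: AB; lia.
Qed.

Lemma misses_catD (A : set nat) a n :
  misses A (a + n) = (misses A a + misses [set i | A (i + a)%N] n)%N.
Proof.
rewrite /misses iotaD count_cat; congr addn.
rewrite [(1 + a)%N]addnC iotaDl count_map; apply: eq_count => i /=.
by congr negb; apply/idP/idP; rewrite !inE /= addnC.
Qed.

Lemma fullP (R : realType) (A : set nat) : upper_density R A = 1%E <-> full A.
Proof.
have countE n : (count (mem A) (iota 1 n))%:R = n%:R - (misses A n)%:R :> R.
  rewrite -[in n%:R](size_iota 1 n) -(count_predC (mem A)) natrD /misses.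
  by rewrite (@eq_count _ (fun i => i \notin A) (predC (mem A)))// addrK.
rewrite /upper_density /limn_esup limf_esupE; split.
  move=> dA k N.
  have : (1 <= ereal_sup ((fun n => ((count (mem A) (iota 1 n))%:R / n%:R : R)%:E)
      @` [set n | (N.+1 <= n)%N]))%E.
    rewrite -dA; apply: ereal_inf_lbound => /=.
    by exists [set n | (N.+1 <= n)%N] => //; exists N.+1.
  move=> s1.
  (* [k.+1] rather than [k], which may be zero *)
  have /lt_le_trans/(_ s1) : ((1 - k.+1%:R^-1 : R)%:E < 1)%E.
    by rewrite lte_fin ltrBlDr ltrDl invr_gt0.
  move=> /ereal_sup_gt[_ [n /= Nn <-]]; rewrite lte_fin countE.
  have n0 : (0 < n)%N by lia.
  rewrite mulrBl mulfV ?pnatr_eq0 ?lt0n_neq0// ltrD2l ltrN2.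
  rewrite ltr_pdivrMr ?ltr0n// mulrC ltr_pdivlMr ?ltr0n// -natrM ltr_nat => h.
  by exists n; [lia|apply: leq_ltn_trans h; rewrite mulnC leq_mul].
move=> fA; apply/eqP; rewrite eq_le; apply/andP; split.
  apply: ge_ereal_inf; eexists; first by exists setT; [exact: filterT|].
  apply: ge_ereal_sup => _ [n _ <-]; rewrite lee_fin countE.
  case: n => [|n]; first by rewrite invr0 mulr0.
  by rewrite ler_pdivrMr ?ltr0n// mul1r gerBl.
apply: le_ereal_inf_tmp => _ [V [N _ NV] <-].
apply/lee_addgt0Pr => e e0.
pose k := (Num.truncn e^-1).+1.
have [n nN kn] := fA k (maxn N 1).
apply: (@le_trans _ _ ((((count (mem A) (iota 1 n))%:R / n%:R : R) + e)%:E)); last first.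
  rewrite EFinD leeD2r//; apply: ereal_sup_ubound; exists n => //; apply: NV => /=; lia.
have n0 : (0 < n)%N by lia.
rewrite lee_fin countE mulrBl mulfV ?pnatr_eq0 ?lt0n_neq0//.
rewrite -addrA lerDl addrC subr_ge0 ler_pdivrMr ?ltr0n//.
have ke : e^-1 < k%:R by rewrite /k truncnS_gt.
have : k%:R * (misses A n)%:R < n%:R :> R by rewrite -natrM ltr_nat.
move=> /ltW h; rewrite -ler_pdivrMl//; apply: le_trans h.
by rewrite ler_wpM2r// ltW.
Qed.

Lemma fullS (A B : set nat) : A `<=` B -> full A -> full B.
Proof.
move=> AB fA k N; have [n Nn kn] := fA k N; exists n => //.
apply: leq_ltn_trans kn; rewrite leq_mul// misses_mono// => i _; exact: AB.
Qed.

Lemma full_setT : full setT.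
Proof.
move=> k N; exists N.+1 => //; rewrite (_ : misses _ _ = 0%N) ?muln0//.
apply/eqP; rewrite -leqn0 leqNgt -has_count; apply/hasPn => i _.
by rewrite negbK inE.
Qed.

Lemma full_shift a (A : set nat) : full A -> full [set i | A (i + a)%N].
Proof.
move=> fA k N; have [n Nn kn] := fA (2 * k)%N (N + 2 * a).+1.
exists (n - a)%N; first lia.
have := misses_catD A a (n - a); rewrite subnKC; last lia.
nia.
Qed.

Lemma full_from N (A : set nat) : full A -> full [set i | A i /\ (N <= i)%N].
Proof.
(* half of the segment pays for the [N] times that are removed *)
move=> fA k M; have [n Mn kn] := fA (2 * k)%N (M + N + 2 * k * N).+1.
exists n; first lia.
have -> : n = (N + (n - N))%N by lia.
have := misses_catD A N (n - N).
have := misses_catD [set i | A i /\ (N <= i)%N] N (n - N).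
have := misses_le [set i | A i /\ (N <= i)%N] N.
have : (misses [set i | [set i | A i /\ (N <= i)%N] (i + N)%N] (n - N) <=
     misses [set i | A (i + N)%N] (n - N))%N.
  by apply: misses_mono => i _ /= Ai; split => //; lia.
rewrite !subnKC; last lia.
nia.
Qed.

Lemma full_unbounded N (A : set nat) : full A -> exists2 a, A a & (N <= a)%N.
Proof.
move=> /(full_from N) /(_ 1%N 1%N)[n n0]; rewrite mul1n => h.
apply: contrapT => h2; move: h; apply/negP; rewrite -leqNgt.
rewrite -[leqLHS](size_iota 1) /misses -count_predT.
apply: sub_count => i _; apply/negP; rewrite inE => -[Ai Ni].
by apply: h2; exists i.
Qed.

(** Cut the times into blocks [(N q, N q.+1]], each so much longer than
everything before it that [A q] alone already fills almost all of [[1, N q.+1]],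
and follow [A q] on the block number [q]. *)
Lemma full_diagonal (A : nat -> set nat) :
  (forall i, A i.+1 `<=` A i) -> (forall i, full (A i)) ->
  exists2 B, full B & forall k, exists N, forall n, (N <= n)%N -> B n -> A k n.
Proof.
move=> decA fA.
have decA' i j : (i <= j)%N -> A j `<=` A i.
  apply: (@homo_leq _ A (fun B C => C `<=` B)) => // [B|B C D BC CD].
    exact: subset_refl.
  exact: subset_trans CD BC.
have step k M : exists n, (M < n)%N /\ (k.+1 * (misses (A k) n + M) < n)%N.
  have [n Mn kn] := fA k (2 * k.+1)%N (M + 2 * (k.+1 * M)).+1.
  by exists n; nia.
have [h hP] := choice (fun kM : nat * nat => step kM.1 kM.2).
pose N := fix N k := if k is k'.+1 then h (k', N k') else 0%N.
have NS k : (N k < N k.+1)%N by have [] := hP (k, N k).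
have Nlt i j : (i <= j)%N -> (N i <= N j)%N.
  by move=> ij; apply: (homo_leq leqnn leq_trans) ij => l; exact: ltnW.
have Nk k : (k <= N k)%N by elim: k => // k; have := NS k; lia.
pose B := [set n | exists2 k, (N k < n <= N k.+1)%N & A k n].
exists B.
  move=> k M; pose q := maxn k M.
  have [_ /= hq] := hP (q, N q); exists (N q.+1).
    by have := Nk q.+1; rewrite /q; lia.
  have : (misses B (N q.+1) <= misses (A q) (N q.+1) + N q)%N.
    have -> : N q.+1 = (N q + (N q.+1 - N q))%N by have := NS q; lia.
    rewrite !misses_catD [leqRHS]addnC addnA leq_add//; last first.
      apply: misses_mono => i ri /= Ai; exists q => //.
      by have := NS q; lia.
    by apply: leq_trans (leq_addr _ _); exact: misses_le.
  rewrite -[h _]/(N q.+1) in hq; rewrite /q in hq *; nia.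
move=> k; exists (N k).+1 => n kn [j jn Aj]; apply: decA' Aj.
rewrite leqNgt; apply/negP => jk; have := Nlt j.+1 k jk; lia.
Qed.

(** * Fréchet spaces through dyadic balls of seminorms *)

(** Real and complex scalars are treated alike from here on: the arguments only
multiply vectors by integers. *)
Lemma scalar_abs_nat (R : realType) (k : scalar_kind) n :
  scalar_abs (n%:R : scalar_field R k) = n%:R.
Proof.
rewrite /scalar_abs.
case: k; first by rewrite normr_nat.
have ReD (x y : complex R) : complex.Re (x + y) = complex.Re x + complex.Re y.
  by case: x; case: y.
rewrite normr_nat; elim: n => // n IH.
by rewrite -addn1 !natrD ReD IH.
Qed.

Lemma scalar_absN1 (R : realType) (k : scalar_kind) :
  scalar_abs (-1 : scalar_field R k) = 1.
Proof. by rewrite /scalar_abs; case: k; rewrite normrN1. Qed.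

(** Since the seminorms increase, these sets, with one index for both the
seminorm and the radius, form a base of neighbourhoods of the origin; halving
the radius is then the same as increasing the index. *)
Definition dyadic_small (R : realType) (X : Type) (p : nat -> X -> R)
  (j : nat) (x : X) : Prop := p j x < 2^-1 ^+ j.

Section frechet_theory.
Context {R : realType} {k : scalar_kind} {X : tvsType (scalar_field R k)}.
Variables (p : nat -> X -> R).
Hypothesis hX : frechet p.
Local Notation small := (dyadic_small p).

Lemma seminorm_ge0 j x : 0 <= p j x.
Proof. by have [] := frechet_seminorm hX j. Qed.

Lemma seminormD j x y : p j (x + y) <= p j x + p j y.
Proof. by have [] := frechet_seminorm hX j. Qed.

Lemma seminormMn j x n : p j (x *+ n) = n%:R * p j x.
Proof.
have [_ _ pZ] := frechet_seminorm hX j.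
by rewrite -scaler_nat pZ scalar_abs_nat.
Qed.

Lemma seminormN j x : p j (- x) = p j x.
Proof.
have [_ _ pZ] := frechet_seminorm hX j.
by rewrite -scaleN1r pZ scalar_absN1 mul1r.
Qed.

Lemma seminorm0 j : p j 0 = 0.
Proof. by rewrite -(mulr0n 0) seminormMn mul0r. Qed.

Lemma seminormB j x y : p j (x - y) <= p j x + p j y.
Proof. by rewrite -(seminormN j y) seminormD. Qed.

Lemma exp2V_gt0 j : 0 < 2^-1 ^+ j :> R.
Proof. by rewrite exprn_gt0. Qed.

Lemma small0 j : small j 0.
Proof. by rewrite /dyadic_small seminorm0 exp2V_gt0. Qed.

Lemma smallN j x : small j (- x) <-> small j x.
Proof. by rewrite /dyadic_small seminormN. Qed.

Lemma small_distC j x y : small j (x - y) <-> small j (y - x).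
Proof. by rewrite -smallN opprB. Qed.

Lemma exp2V_le i j : (i <= j)%N -> 2^-1 ^+ j <= 2^-1 ^+ i :> R.
Proof. by move=> ij; rewrite ler_wiXn2l// invf_le1// ler1n. Qed.

Lemma small_le i j x : (i <= j)%N -> small j x -> small i x.
Proof.
move=> ij sx; apply: le_lt_trans (frechet_increasing hX x ij) _.
by apply: lt_le_trans sx _; exact: exp2V_le.
Qed.

Lemma exp2VS j : 2^-1 ^+ j.+1 + 2^-1 ^+ j.+1 = 2^-1 ^+ j :> R.
Proof. by rewrite exprS -mulrDl; field. Qed.

Lemma smallD j x y : small j.+1 x -> small j.+1 y -> small j (x + y).
Proof.
rewrite /dyadic_small -(exp2VS j) => sx sy.
apply: le_lt_trans (seminormD j x y) _; rewrite ltrD//.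
  by apply: le_lt_trans sx; exact: (frechet_increasing hX).
by apply: le_lt_trans sy; exact: (frechet_increasing hX).
Qed.

Lemma smallB j x y : small j.+1 x -> small j.+1 y -> small j (x - y).
Proof. by move=> sx /smallN sy; exact: smallD. Qed.

Lemma exp2V_lt (e : R) : 0 < e -> exists j, 2^-1 ^+ j < e.
Proof.
move=> e0; have := @cvg_expr R 2^-1; rewrite ger0_norm ?invr_ge0// invf_lt1// ltr1n.
move=> /(_ isT)/cvgrPdist_lt/(_ _ e0)[N _ /(_ N (leqnn N))].
by rewrite /= sub0r normrN ger0_norm ?exprn_ge0// => h; exists N.
Qed.

Lemma nbhs_smallP (x : X) (U : set X) :
  nbhs x U <-> exists j, forall y, small j (y - x) -> U y.
Proof.
split.
  move=> /(frechet_topology hX)[i [e e0 eU]].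
  have [j je] := exp2V_lt e0; exists (maxn i j) => y syx; apply: eU => /=.
  apply: le_lt_trans (frechet_increasing hX _ (leq_maxl i j)) _.
  apply: lt_le_trans syx (le_trans _ (ltW je)); apply: exp2V_le; exact: leq_maxr.
move=> [j jU]; apply/(frechet_topology hX); exists j, (2^-1 ^+ j) => //.
Qed.

Lemma open_smallP (U : set X) :
  open U <-> forall x, U x -> exists j, forall y, small j (y - x) -> U y.
Proof.
rewrite openE; split=> oU x Ux; first exact/nbhs_smallP/oU.
by apply/nbhs_smallP; exact: oU.
Qed.

Lemma dense_smallP (S : set X) :
  dense S <-> forall x j, exists2 y, small j (y - x) & S y.
Proof.
split=> [dS x j|dS U [x Ux] oU].
  have [] := dS [set y | small j (y - x)]°.
  - by exists x; apply/nbhs_smallP; exists j.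
  - exact: open_interior.
  - by move=> y [/interior_subset ? Sy]; exists y.
have [j jU] := (open_smallP U).1 oU x Ux.
by have [y /jU Uy Sy] := dS x j; exists y.
Qed.

Lemma open_p_lt j (c : R) : open [set x | p j x < c].
Proof.
apply/open_smallP => x /=; rewrite -subr_gt0 => /exp2V_lt[i ic].
exists (maxn i j) => y syx /=; rewrite -(subrK x y).
apply: le_lt_trans (seminormD _ _ _) _; rewrite -ltrBrDr.
apply: le_lt_trans (frechet_increasing hX _ (leq_maxr i j)) _.
by apply: lt_trans syx (le_lt_trans _ ic); apply: exp2V_le; exact: leq_maxl.
Qed.

Lemma open_p_gt j (c : R) : open [set x | c < p j x].
Proof.
apply/open_smallP => x /=; rewrite -subr_gt0 => /exp2V_lt[i ic].
exists (maxn i j) => y syx /=.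
have /= := seminormB j y (y - x); rewrite opprB addrC subrK => h.
have := frechet_increasing hX (y - x) (leq_maxr i j).
have := exp2V_le (leq_maxl i j); rewrite /dyadic_small in syx.
move: ic syx h; lra.
Qed.

Local Notation d := (seminorm_dist p).
Let term (x y : X) i : R := 2^-1 ^+ i.+1 * Num.min 1 (p i (x - y)).

Let term_ge0 x y i : 0 <= term x y i.
Proof. by rewrite mulr_ge0 ?exprn_ge0// le_min ler01 seminorm_ge0. Qed.

Let term_le x y i : term x y i <= 2^-1 ^+ i.+1.
Proof. by rewrite ler_piMr ?exprn_ge0// ge_min lexx. Qed.

Let nd_series x y : nondecreasing_seq (series (term x y)).
Proof. by apply/nondecreasing_seqP => n; rewrite seriesSr lerDl term_ge0. Qed.

Let series_le x y n : series (term x y) n <= 1 - 2^-1 ^+ n.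
Proof.
elim: n => [|n IH]; first by rewrite /series /= big_geq// expr0 subrr.
rewrite seriesSr; have := term_le x y n; have := exp2VS n.
move: (2^-1 ^+ n) (2^-1 ^+ n.+1) IH => a b; lra.
Qed.

Let cvg_series_term x y : cvgn (series (term x y)).
Proof.
apply: nondecreasing_is_cvgn; first exact: nd_series.
exists 1 => _ [n _ <-]; apply: le_trans (series_le x y n) _.
by rewrite gerBl exprn_ge0.
Qed.

(** If [small j (x - y)], the terms of index at most [j] of the series
contribute less than [2^-j], and so do the others. Together with [dist_small],
this turns every statement about the metric into one about [small]. *)
Lemma small_dist (e : R) : 0 < e ->
  exists j, forall x y, small j (x - y) -> d x y < e.
Proof.
move=> /exp2V_lt[j je]; exists j.+2 => x y sxy.
apply: le_lt_trans je; apply: limr_le; first exact: cvg_series_term.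
apply: nearW => n.
suff: series (term x y) n <= 2^-1 ^+ j.+2 * (1 - 2^-1 ^+ n) +
    (2^-1 ^+ j.+2 - 2^-1 ^+ (maxn n j.+2)).
  have := exp2V_gt0 n; have := exp2V_gt0 (maxn n j.+2).
  have := exp2V_gt0 j.+2; have := exp2VS j.+1; have := exp2VS j; have := exp2V_gt0 j.+1.
  move: (2^-1 ^+ n) (2^-1 ^+ j.+2) (2^-1 ^+ j.+1) (2^-1 ^+ (maxn _ _)) => a b c f; nra.
elim: n => [|n IH]; first by rewrite /series /= big_geq// max0n expr0 !subrr mulr0 addr0.
rewrite seriesSr.
have [nj|nj] := leqP n.+1 j.+2.
  have {}IH : series (term x y) n <= 2^-1 ^+ j.+2 * (1 - 2^-1 ^+ n).
    by apply: le_trans IH _; rewrite (maxn_idPr _) ?subrr ?addr0//; exact: ltnW.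
  have h : term x y n <= 2^-1 ^+ n.+1 * 2^-1 ^+ j.+2.
    rewrite ler_wpM2l ?exprn_ge0// ge_min; apply/orP; right.
    apply: le_trans (frechet_increasing hX _ _) (ltW sxy); lia.
  rewrite subrr addr0; move: IH h.
  rewrite -(exp2VS n).
  move: (2^-1 ^+ n.+1) (2^-1 ^+ j.+2) => a b; lra.
have {}IH : series (term x y) n <= 2^-1 ^+ j.+2 * (1 - 2^-1 ^+ n) +
    (2^-1 ^+ j.+2 - 2^-1 ^+ n) by rewrite (maxn_idPl _) in IH.
have := term_le x y n; move: IH; have := exp2V_gt0 j.+2.
have := exp2V_gt0 n.+1.
rewrite -(exp2VS n).
move: (2^-1 ^+ n.+1) (2^-1 ^+ j.+2) => a b; nra.
Qed.

Lemma dist_ge (j : nat) x y :  2^-1 ^+ j.+1 * Num.min 1 (p j (x - y)) <= d x y.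
Proof.
apply: limr_ge; first exact: cvg_series_term.
exists j.+1 => // n /= jn; apply: le_trans (nd_series x y jn).
rewrite seriesSr lerDr.
by rewrite /series /= sumr_ge0// => i _; exact: term_ge0.
Qed.

Lemma dist_small j : exists2 e : R, 0 < e & forall x y, d x y < e -> small j (x - y).
Proof.
exists (2^-1 ^+ j.+1 * 2^-1 ^+ j); first by rewrite mulr_gt0// exp2V_gt0.
move=> x y /(le_lt_trans (dist_ge j x y)).
rewrite ltr_pM2l ?exp2V_gt0// gt_min => /orP[|//].
by rewrite ltNge exprn_ile1// invf_le1// ler1n.
Qed.

Lemma cvg0_smallP (F : set_system nat) (FF : Filter F) (u : nat -> X) :
  u @ F --> (0 : X) <-> forall j, F [set n | small j (u n)].
Proof.
split=> [u0 j|u0 U].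
  apply: (u0 [set z | small j z]); apply/nbhs_smallP; exists j => y.
  by rewrite subr0.
move=> /nbhs_smallP[j jU]; apply: filterS (u0 j) => n /= sn; apply: jU.
by rewrite subr0.
Qed.

Lemma cauchy_smallP (u : nat -> X) :
  (forall j, exists N, forall n, (N <= n)%N -> small j (u n - u N)) ->
  exists l, forall j, exists N, forall n, (N <= n)%N -> small j (u n - l).
Proof.
move=> cu; have [|l ul] := frechet_complete hX (u := u).
  move=> e /small_dist[j je]; have [N Nj] := cu j.+1; exists N => m n Nm Nn.
  apply: je; rewrite -(subrK (u N) (u m)) -addrA; apply: smallD; first exact: Nj.
  by apply/small_distC; exact: Nj.
exists l => j; have [|N _ NP] := ul [set z | small j (z - l)]; last by exists N.
by apply/nbhs_smallP; exists j.
Qed.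

End frechet_theory.

(** * Baire category *)

Lemma dependent_choice_seq (S : Type) (I : S -> Prop) (Q : nat -> S -> S -> Prop)
    (s0 : S) :
  I s0 -> (forall n s, I s -> exists2 s', Q n s s' & I s') ->
  exists u : nat -> S, [/\ u 0%N = s0, forall n, I (u n) & forall n, Q n (u n) (u n.+1)].
Proof.
move=> I0 step.
have stepT (ns : nat * {s | I s}) :
    exists s' : {s | I s}, Q ns.1 (proj1_sig ns.2) (proj1_sig s').
  case: ns => n [s Is] /=; have [s' Qs' Is'] := step n s Is.
  by exists (exist _ s' Is').
have [f fP] := choice stepT.
pose u := fix u n := if n is n'.+1 then f (n', u n') else exist _ s0 I0.
exists (fun n => proj1_sig (u n)); split=> // n; first exact: proj2_sig.
exact: (fP (n, u n)).
Qed.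

(** Equivalent to being residual in a Fréchet space ([residualP]), but stable
under countable intersections without any appeal to completeness. *)
Definition comeager (X : topologicalType) (S : set X) : Prop :=
  exists2 U : nat -> set X,
    forall i, open (U i) /\ dense (U i) & \bigcap_i U i `<=` S.

Lemma denseT (X : topologicalType) : dense [set: X].
Proof. by move=> O [x Ox] _; exists x. Qed.

Lemma denseS (X : topologicalType) (S S' : set X) :
  S `<=` S' -> dense S -> dense S'.
Proof. by move=> SS dS O O0 oO; have [x [Ox /SS S'x]] := dS O O0 oO; exists x. Qed.

Lemma comeagerS (X : topologicalType) (S S' : set X) :
  S `<=` S' -> comeager S -> comeager S'.
Proof. by move=> SS [U oU US]; exists U => //; exact: subset_trans SS. Qed.

Lemma comeager_bigcap (X : topologicalType) (S : nat -> set X) :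
  (forall i, comeager (S i)) -> comeager (\bigcap_i S i).
Proof.
move=> cS.
have cS2 i : exists U : nat -> set X,
    (forall j, open (U j) /\ dense (U j)) /\ \bigcap_j U j `<=` S i.
  by have [U] := cS i; exists U.
have [U UP] := choice cS2.
exists (fun n => if unpickle n is Some (i, j) then U i j else setT).
  move=> n; case: unpickle => [[i j]|]; first exact: (UP i).1.
  by split; [exact: openT|exact: denseT].
move=> x Ux i _; apply: (UP i).2 => j _.
by have := Ux (pickle (i, j)) I; rewrite pickleK.
Qed.

Lemma comeagerT (X : topologicalType) : comeager [set: X].
Proof.
by exists (fun=> setT) => // i; split; [exact: openT|exact: denseT].
Qed.

Lemma comeagerI (X : topologicalType) (A B : set X) :
  comeager A -> comeager B -> comeager (A `&` B).
Proof.
move=> cA cB; have := @comeager_bigcap X (fun i => if i is 0%N then A else B).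
move=> /(_ _) cAB; apply: comeagerS (cAB _); last by case.
by move=> x h; split; [exact: (h 0%N)|exact: (h 1%N)].
Qed.

Lemma comeager_all_in (X : topologicalType) (I : eqType) (s : seq I) (P : I -> set X) :
  (forall i, i \in s -> comeager (P i)) ->
  comeager [set x | forall i, i \in s -> P i x].
Proof.
elim: s => [|i s IH] cP; first by apply: comeagerS (comeagerT X) => x _ i.
apply: comeagerS (comeagerI (cP i (mem_head _ _)) (IH _)).
  by move=> x [Pi Ps] j; rewrite inE => /predU1P[->|/Ps].
by move=> j js; apply: cP; rewrite inE js orbT.
Qed.

Section frechet_category.
Context {R : realType} {k : scalar_kind} {X : tvsType (scalar_field R k)}.
Variables (p : nat -> X -> R).
Hypothesis hX : frechet p.
Local Notation small := (dyadic_small p).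

(** Baire's theorem: in a nested sequence of balls with increasing indices, the
centers form a Cauchy sequence. Each ball lies in the ball of the next index
around the previous center, so that the limit remains in all of them. *)
Lemma comeager_dense (S : set X) : comeager S -> dense S.
Proof.
move=> [U UP US]; apply: denseS US _; apply/(dense_smallP hX) => x0 j0.
pose Q n (s s' : X * nat) := (s.2 < s'.2)%N /\
  forall y, small s'.2 (y - s'.1) -> U n y /\ small s.2.+1 (y - s.1).
have [n [x j] _|u [u0 _ uQ]] :=
    @dependent_choice_seq _ (fun=> True) Q (x0, j0) I.
  have [oU /(dense_smallP hX) /(_ x j.+2)[y yx Uy]] := UP n.
  have [i iU] := (open_smallP hX _).1 oU y Uy.
  exists (y, maxn i j.+2) => //; split => /= [|z zy]; first lia.
  split; first by apply: iU; apply: small_le zy => //; exact: leq_maxl.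
  rewrite -(subrK y z) -addrA; apply: smallD => //.
  by apply: small_le zy => //; exact: leq_maxr.
have ball_sub n m y : (n <= m)%N ->
    small (u m).2 (y - (u m).1) -> small (u n).2 (y - (u n).1).
  move=> nm; apply: (@homo_leq _ (fun m => [set y | small (u m).2 (y - (u m).1)])
    (fun A B => B `<=` A)) nm y => [A //|A B C BA CB|i y yi].
    exact: subset_trans BA.
  have [_ /(_ y yi)[_]] := uQ i; exact: small_le.
have center n m : (n < m)%N -> small (u n).2.+1 ((u m).1 - (u n).1).
  move=> nm; have [_ /(_ (u m).1)] := uQ n; case=> //.
  by apply: ball_sub nm _; rewrite subrr; exact: small0.
have j_ge n : (n <= (u n).2)%N.
  by elim: n => // n IH; have [+ _] := uQ n; exact: leq_ltn_trans.
have [j|l lP] := cauchy_smallP hX (u := fun n => (u n).1).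
  exists j => n; rewrite leq_eqVlt => /predU1P[->|/center].
    by rewrite subrr; exact: small0.
  by apply: small_le => //; exact: leqW.
have l_in n : small (u n).2 (l - (u n).1).
  have [N NP] := lP (u n).2.+1.
  rewrite -(subrK (u (maxn N n.+1)).1 l) -addrA; apply: smallD => //.
    by apply/small_distC => //; apply: NP; exact: leq_maxl.
  by apply: center; exact: leq_maxr.
exists l; first by have := l_in 0%N; rewrite u0.
by move=> n _; have [_ /(_ l (l_in n.+1))[]] := uQ n.
Qed.

Lemma residualP (S : set X) : residual S <-> comeager S.
Proof.
split=> [[G [[U oU GU] dG GS]]|cS].
  exists U; last by rewrite -GU.
  move=> i; split=> //; apply: denseS dG.
  by rewrite GU; exact: bigcap_inf.
have [U UP US] := cS; exists (\bigcap_i U i); split => //.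
  by exists U => // i; have [] := UP i.
by apply: comeager_dense; exists U.
Qed.

Lemma comeager_preimage (f g : X -> X) (S : set X) :
  (forall x y j, small j (x - y) -> small j (f x - f y)) ->
  (forall x y j, small j (x - y) -> small j (g x - g y)) ->
  cancel f g -> cancel g f -> comeager S -> comeager (f @^-1` S).
Proof.
move=> fs gs fK gK [U UP US]; exists (fun i => f @^-1` U i).
  move=> i; have [oU dU] := UP i; split.
    apply/(open_smallP hX) => x /((open_smallP hX _).1 oU)[j jU].
    by exists j => y yx; apply: jU; exact: fs.
  apply/(dense_smallP hX) => x j.
  have [y yx Uy] := (dense_smallP hX _).1 dU (f x) j.
  exists (g y); last by rewrite /preimage /= gK.
  by rewrite -[x in _ - x]fK; exact: gs.
by move=> x Ux; apply: US => i _; exact: Ux.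
Qed.

Lemma comeager_addl (a : X) (S : set X) :
  comeager S -> comeager [set v | S (a + v)].
Proof.
apply: (comeager_preimage (g := fun v => v - a)).
- by move=> x y j; rewrite opprD addrACA subrr add0r.
- by move=> x y j; rewrite opprB addrA subrK.
- by move=> x; rewrite addrAC subrr add0r.
- by move=> x; rewrite addrC subrK.
Qed.

Lemma comeager_subl (a : X) (S : set X) :
  comeager S -> comeager [set v | S (a - v)].
Proof.
apply: (comeager_preimage (g := fun v => a - v)).
- by move=> x y j /= /(small_distC hX); rewrite opprB [X in _ -> small _ X]addrC addrA subrK.
- by move=> x y j /= /(small_distC hX); rewrite opprB [X in _ -> small _ X]addrC addrA subrK.
- by move=> x /=; rewrite subKr.
- by move=> x /=; rewrite subKr.
Qed.

End frechet_category.

(** * Cantor sets *)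

Definition agree (n : nat) (a b : nat -> bool) : Prop :=
  forall i, (i < n)%N -> a i = b i.

Lemma first_disagreement n (a b : nat -> bool) :
  ~ agree n a b -> exists i, [/\ (i < n)%N, agree i a b & a i <> b i].
Proof.
elim: n => [|n IH] nab; first by exfalso; apply: nab => i.
have [ab|/IH[i [lti ab abi]]] := pselect (agree n a b); last first.
  by exists i; split=> //; exact: ltnW.
exists n; split=> // abn; apply: nab => i.
by rewrite ltnS leq_eqVlt => /predU1P[->|/ab].
Qed.

Section ternary.
Context {R : realType}.
Implicit Types a b : nat -> bool.

Local Notation digit_term a := (fun n => (2 * a n)%:R * (3^-1 : R) ^+ n.+1).

Definition ternary a : R := limn (series (digit_term a)).

Lemma cantor_ternaryP (x : R) :
  cantor_ternary_set x <-> exists a, x = ternary a.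
Proof. by []. Qed.

Let third n : 3^-1 ^+ n = 3 * 3^-1 ^+ n.+1 :> R.
Proof. by rewrite exprS mulrA mulfV ?mul1r. Qed.

Let third_gt0 n : 0 < 3^-1 ^+ n :> R.
Proof. by rewrite exprn_gt0. Qed.

Let digit_term_ge0 a n : 0 <= (digit_term a) n.
Proof. by rewrite mulr_ge0// ltW. Qed.

Let digit_term_le a n : (digit_term a) n <= 2 * 3^-1 ^+ n.+1.
Proof. by rewrite ler_pM2r// ler_nat; case: (a n). Qed.

Let nd_digits a : nondecreasing_seq (series (digit_term a)).
Proof. by apply/nondecreasing_seqP => n; rewrite seriesSr lerDl. Qed.

Let tail_le a n m : (n <= m)%N ->
  series (digit_term a) m <= series (digit_term a) n + 3^-1 ^+ n - 3^-1 ^+ m.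
Proof.
move=> /subnKC <-; elim: (m - n)%N => [|l IH]; first by rewrite addn0 addrK.
rewrite addnS seriesSr; move: IH (digit_term_le a (n + l)).
rewrite (third (n + l)); lra.
Qed.

Let cvg_digits a : cvgn (series (digit_term a)).
Proof.
apply: nondecreasing_is_cvgn; first exact: nd_digits.
exists 1 => _ [n _ <-]; apply: le_trans (tail_le a (leq0n n)) _.
by rewrite /series /= big_geq// add0r expr0 gerBl ltW.
Qed.

Let ternary_ge a n : series (digit_term a) n <= ternary a.
Proof.
apply: limr_ge; first exact: cvg_digits.
by exists n => // m /=; exact: nd_digits.
Qed.

Let ternary_le a n : ternary a <= series (digit_term a) n + 3^-1 ^+ n.
Proof.
apply: limr_le; first exact: cvg_digits.
exists n => // m /= nm; apply: le_trans (tail_le a nm) _.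
by rewrite gerBl ltW.
Qed.

Let series_agree n a b : agree n a b ->
  series (digit_term a) n = series (digit_term b) n.
Proof.
by move=> ab; apply: eq_big_nat => i /andP[_ ni]; rewrite ab.
Qed.

Lemma ternary_continuous (e : R) : 0 < e ->
  exists n, forall a b, agree n a b -> `|ternary a - ternary b| < e.
Proof.
move=> e0; have := @cvg_expr R 3^-1; rewrite ger0_norm ?invr_ge0// invf_lt1// ltr1n.
move=> /(_ isT)/cvgrPdist_lt/(_ _ e0)[n _ /(_ n (leqnn n))].
rewrite /= sub0r normrN ger0_norm ?exprn_ge0// => ne; exists n => a b ab.
have := ternary_ge a n; have := ternary_le a n.
have := ternary_ge b n; have := ternary_le b n.
rewrite (series_agree ab) => *; rewrite ltr_norml; apply/andP; split; lra.
Qed.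

(** Two expansions first differing at the digit [i] are separated by the gap
[3^-(i+1)] which the ternary set leaves between the digits 0 and 2. *)
Lemma ternary_separates (n : nat) :
  exists2 e : R, 0 < e & forall a b, `|ternary a - ternary b| < e -> agree n a b.
Proof.
exists (3^-1 ^+ n) => // a b; apply: contraPP => /first_disagreement[i [ni]].
wlog [ai bi] : a b / a i = true /\ b i = false => [wl|].
  case ai: (a i); case bi : (b i) => // iab _.
    by apply: (wl a b) => //; rewrite ai bi.
  rewrite distrC; apply: (wl b a) => // [j ji|]; first by rewrite iab.
  by rewrite bi ai.
move=> iab _; apply/negP; rewrite -leNgt; apply: le_trans (ler_norm _).
have := ternary_ge a i.+1; have := ternary_le b i.+1.
rewrite !seriesSr (series_agree iab) ai bi mul0r muln1 addr0.
have : 3^-1 ^+ n <= 3^-1 ^+ i.+1 :> R by rewrite ler_wiXn2l// invf_le1// ler1n.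
lra.
Qed.

End ternary.

Lemma cantor_set_two_points (R : realType) (X : topologicalType) (K : set X) :
  cantor_set R K -> exists x y, [/\ K x, K y & x <> y].
Proof.
move=> [f [g [_ _ fg _]]].
have C a : @cantor_ternary_set R (ternary a) by exists a.
have [Kt gt] := fg _ (C xpredT); have [Kf gf] := fg _ (C xpred0).
exists (f (ternary xpredT)), (f (ternary xpred0)); split => // /(congr1 g).
rewrite gt gf => tf; have [e e0 sep] := @ternary_separates R 1.
by have := sep xpredT xpred0; rewrite tf subrr normr0 => /(_ e0 0%N isT).
Qed.

Section cantor_sets.
Context {R : realType} {k : scalar_kind} {X : tvsType (scalar_field R k)}.
Variables (p : nat -> X -> R).
Hypothesis hX : frechet p.
Local Notation small := (dyadic_small p).

(** A map from binary sequences that is uniformly continuous, with a uniformly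
continuous inverse, for the agreement of initial segments. The ternary expansion
is another such map, and their composition is the homeomorphism. *)
Lemma cantor_set_range (phi : (nat -> bool) -> X) :
  (forall j, exists n, forall a b, agree n a b -> small j (phi a - phi b)) ->
  (forall n, exists j, forall a b, small j (phi a - phi b) -> agree n a b) ->
  cantor_set R (range phi).
Proof.
move=> phi_cont phi_sep.
have /choice[digits digitsP] : forall x : R, exists a,
    cantor_ternary_set x -> x = ternary a.
  move=> x; have [[a ->]|nx] := pselect (@cantor_ternary_set R x); first by exists a.
  by exists xpred0.
have /choice[code codeP] : forall x, exists a, range phi x -> x = phi a.
  move=> x; have [[a _ <-]|nx] := pselect (range phi x); first by exists a.
  by exists xpred0.
have digitsK a : digits (ternary a) = a.
  apply/funext => i; have [e e0 sep] := @ternary_separates R i.+1.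
  apply: sep (ltnSn i); rewrite -digitsP ?subrr ?normr0//; exact: ex_intro.
have codeK a : code (phi a) = a.
  apply/funext => i; have [j sep] := phi_sep i.+1.
  by apply: sep (ltnSn i); rewrite -codeP ?subrr; [exact: small0|exists a].
exists (fun x => phi (digits x)), (fun y => ternary (code y)); split.
- apply/subspace_continuousP => _ /cantor_ternaryP[a ->] U.
  rewrite /from_subspace digitsK => /(nbhs_smallP hX)[j jU].
  have [n nj] := phi_cont j; have [e e0 en] := @ternary_separates R n.
  apply/nbhs_ballP; exists e => // _ /= /[swap] /cantor_ternaryP[b ->] ae; apply: jU.
  rewrite digitsK; apply/(small_distC hX); apply: nj.
  exact: en ae.
- apply/subspace_continuousP => _ [a _ <-] U; rewrite /from_subspace codeK => /nbhs_ballP[e e0 eU].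
  have [n ne] := ternary_continuous e0; have [j jn] := phi_sep n.
  apply/(nbhs_smallP hX); exists j => _ /[swap] -[b _ <-] ba; apply: eU => /=.
  rewrite /ball /= codeK distrC; apply: ne; exact: jn.
- move=> _ /cantor_ternaryP[a ->]; rewrite digitsK codeK; split => //.
- move=> _ [a _ <-]; rewrite codeK digitsK; split => //.
  by exists a.
Qed.

End cantor_sets.

(** * Scrambled Cantor sets in a comeager difference set *)

Lemma uniform_bound_in (I : eqType) (s : seq I) (P : nat -> I -> Prop) :
  (forall i m n, (m <= n)%N -> P m i -> P n i) ->
  (forall i, i \in s -> exists n, P n i) -> exists n, forall i, i \in s -> P n i.
Proof.
move=> mono; elim: s => [|i s IH] ex; first by exists 0%N.
have [j js|n Pn] := IH; first by apply: ex; rewrite inE js orbT.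
have [m Pm] := ex i (mem_head _ _); exists (maxn m n) => j.
rewrite inE => /predU1P[->|/Pn]; first exact: mono (leq_maxl m n) Pm.
exact: mono (leq_maxr m n).
Qed.

Section mycielski.
Context {R : realType} {k : scalar_kind} {X : tvsType (scalar_field R k)}.
Variables (p : nat -> X -> R).
Hypothesis hX : frechet p.
Local Notation small := (dyadic_small p).

Definition subsum (v : nat -> X) (n : nat) (a : nat -> bool) : X :=
  \sum_(l < n) v l *+ a l.

Lemma subsumS v n a : subsum v n.+1 a = subsum v n a + v n *+ a n.
Proof. by rewrite /subsum big_ord_recr. Qed.

Lemma subsum_agree v n a b : agree n a b -> subsum v n a = subsum v n b.
Proof. by move=> ab; apply: eq_bigr => i _; rewrite ab. Qed.

Lemma agreeS n a b : agree n a b -> a n = b n -> agree n.+1 a b.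
Proof. by move=> ab abn i; rewrite ltnS leq_eqVlt => /predU1P[->|/ab]. Qed.

Section generic_sequence.
Variables (U O : nat -> set X).
Hypothesis UP : forall i, open (U i) /\ dense (U i).
Hypothesis U0 : ~ (\bigcap_i U i) 0.
Hypothesis OP : forall j, open (O j) /\ O j !=set0.

Let G := \bigcap_i U i.

Let extend (F : seq X) (v : X) : seq X :=
  F ++ [seq f + v | f <- 0 :: F] ++ [seq f - v | f <- 0 :: F].

(** The ball of index [e] around [f] stays in the open sets [U i] met so far and
does not contain the origin; the latter is what makes the coding by binary
sequences injective with a continuous inverse. *)
Let good (n e : nat) (f : X) :=
  ~ small e f /\ forall i y, (i <= n)%N -> small e (y - f) -> U i y.

Let good_le n f e e' : (e <= e')%N -> good n e f -> good n e' f.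
Proof.
move=> ee [nf fU]; split; first by move=> /(small_le hX ee).
by move=> i y ni /(small_le hX ee); exact: fU.
Qed.

Let good_ex n f : G f -> exists e, good n e f.
Proof.
move=> Gf.
have [j /= jf] : exists j, ~ small j f.
  apply: contrapT => /forallNP nj; apply: U0.
  rewrite (_ : 0 = f) //; apply/esym/(frechet_separating hX) => i.
  apply/eqP; rewrite eq_le seminorm_ge0// andbT leNgt; apply/negP => /exp2V_lt[j jf].
  have /contrapT sf := nj (maxn i j).
  have := le_lt_trans (frechet_increasing hX f (leq_maxl i j)) sf.
  by apply/negP; rewrite -leNgt (le_trans _ (ltW jf))// exp2V_le// leq_maxr.
have [e fe] : exists e, forall i, i \in iota 0 n.+1 -> forall y, small e (y - f) -> U i y.
  apply: uniform_bound_in => [i e e' ee h y /(small_le hX ee)|i _]; first exact: h.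
  exact: (open_smallP hX _).1 (UP i).1 f (Gf i I).
exists (maxn j e); split; first by move=> /(small_le hX (leq_maxl j e)).
move=> i y ni /(small_le hX (leq_maxr j e)); apply: fe.
by rewrite mem_iota.
Qed.

(** A state consists of the list [F] of nontrivial combinations of the vectors
already chosen, the last vector, and the index of a ball by which later vectors
may still perturb the combinations. Vectors of even rank meet the prescribed
open sets, those of odd rank are small. *)
Let step (n : nat) (s s' : seq X * X * nat) : Prop :=
  let: (F, _, e) := s in let: (F', v, e') := s' in
  [/\ F' = extend F v, (e < e')%N, forall f, f \in F' -> good n e' f &
    if odd n then small (e + 4) v
    else forall y, small e' (y - v) -> O n./2 y].

Let step_ex n s : (forall f, f \in s.1.1 -> G f) ->
  exists2 s', step n s s' & forall f, f \in s'.1.1 -> G f.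
Proof.
case: s => [[F v0] e] /= FG.
have cG : comeager G by exists U.
pose W := if odd n then [set v | small (e + 4) v] else O n./2.
have [oW W0] : open W /\ W !=set0.
  rewrite /W; case: ifP => _ //; split; last by exists 0; exact: small0.
  exact: (open_p_lt hX).
have : comeager [set v | forall d, d \in 0 :: F -> G (d + v) /\ G (d - v)].
  apply: (comeager_all_in (P := fun d => [set v | G (d + v) /\ G (d - v)])) => d _.
  apply: comeagerI; first exact: (comeager_addl hX).
  exact: (comeager_subl hX).
move=> /(comeager_dense hX)/(_ W W0 oW)[v [Wv vG]].
have F'G f : f \in extend F v -> G f.
  rewrite !mem_cat => /or3P[/FG//| |] /mapP[d dF ->]; by have [] := vG d dF.
have [e1 e1P] : exists e', forall f, f \in extend F v -> good n e' f.
  apply: uniform_bound_in => [f e1 e2|f fF]; first exact: good_le.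
  exact/good_ex/F'G.
have [e2 e2W] := (open_smallP hX W).1 oW v Wv.
exists (extend F v, v, maxn e.+1 (maxn e1 e2)) => //; split => //.
- exact: leq_maxl.
- move=> f /e1P; apply: good_le.
  exact: leq_trans (leq_maxl _ _) (leq_maxr _ _).
- move: Wv e2W; rewrite /W; case: ifP => // _ _ e2W y sy; apply: e2W.
  apply: small_le sy => //.
  exact: leq_trans (leq_maxr _ _) (leq_maxr _ _).
Qed.

(** A combination with coefficients in [{-1, 0, 1}] is encoded as a difference of
two subset sums, which is also the form in which it arises between two points of
the scrambled set.  The ball of index [E n] is what the later vectors may use up
when added to combinations of the first [n]. *)
Lemma generic_sequence : exists (v : nat -> X) (E : nat -> nat), [/\
  forall n, (E n < E n.+1)%N,
  forall n, odd n -> small (E n + 4) (v n),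
  forall j y, small (E (2 * j).+1) (y - v (2 * j)%N) -> O j y &
  forall n a b, ~ agree n a b ->
    let f := subsum v n a - subsum v n b in
    ~ small (E n) f /\ forall i y, (i < n)%N -> small (E n) (y - f) -> U i y].
Proof.
have [|n s|u [u0 _ uP]] := @dependent_choice_seq _
    (fun s => forall f, f \in s.1.1 -> G f) step ([::], 0, 0%N).
- by [].
- exact: step_ex.
pose F n := (u n).1.1; pose v n := (u n.+1).1.2; pose E n := (u n).2.
have {}uP n : [/\ F n.+1 = extend (F n) (v n), (E n < E n.+1)%N,
    forall f, f \in F n.+1 -> good n (E n.+1) f &
    if odd n then small (E n + 4) (v n)
    else forall y, small (E n.+1) (y - v n) -> O n./2 y].
  move: (uP n); rewrite /step /F /v /E.
  by case: (u n) => [[? ?] ?]; case: (u n.+1) => [[? ?] ?].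
have diffF n a b : ~ agree n a b -> subsum v n a - subsum v n b \in F n.
  elim: n a b => [|n IH] a b nab; first by exfalso; apply: nab.
  have diffF0 : subsum v n a - subsum v n b \in 0 :: F n.
    have [/subsum_agree ->|/IH] := pselect (agree n a b).
      by rewrite subrr mem_head.
    by rewrite inE orbC => ->.
  have [-> _ _ _] := uP n; rewrite !subsumS opprD addrACA.
  have [ab|/eqP ab] := eqVneq (a n) (b n).
    rewrite ab subrr addr0 mem_cat IH// => agn; apply: nab; exact: agreeS.
  rewrite !mem_cat; apply/orP; right; case: (a n) (b n) ab => [] [] // _.
    by rewrite mulr1n mulr0n subr0 (map_f (fun f => f + v n)).
  by rewrite mulr1n mulr0n sub0r (map_f (fun f => f - v n)) ?orbT.
exists v, E; split.
- by move=> n; have [] := uP n.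
- by move=> n on; have [_ _ _] := uP n; rewrite on.
- move=> j y; have [_ _ _] := uP (2 * j)%N.
  by rewrite mul2n odd_double doubleK; exact.
- move=> [|n] a b nab /=; first by exfalso; apply: nab.
  have [_ _ /(_ _ (diffF _ _ _ nab))[nf fU] _] := uP n.
  by split.
Qed.

End generic_sequence.

Section cantor_scheme.
Variables (v : nat -> X) (E : nat -> nat).
Hypothesis E_lt : forall n, (E n < E n.+1)%N.
Hypothesis small_v : forall n, odd n -> small (E n + 4) (v n).

(** The vectors of even rank are not small; a subset sum converges when it uses
finitely many of them. *)
Definition odd_from (n : nat) (a : nat -> bool) : Prop :=
  forall l, (n <= l)%N -> ~~ odd l -> a l = false.

(** Each vector of odd rank is small compared with [E] at its own rank, so the
sums telescope from the right: [v n] and the tail from [n.+1] on are both small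
of index [E n + 4]. *)
Lemma small_subsum_tail a t n : odd_from n a ->
  small (E n + 3) (subsum v (n + t) a - subsum v n a).
Proof.
elim: t n => [|t IH] n an; first by rewrite addn0 subrr; exact: small0.
have an1 : odd_from n.+1 a by move=> l nl; apply: an; exact: ltnW.
rewrite -(addSnnS n t) -(subrK (subsum v n.+1 a) (subsum v (n.+1 + t) a)) -addrA.
apply: smallD => //.
  by apply: small_le (IH _ an1) => //; have := E_lt n; lia.
rewrite subsumS addrC addKr -addnS.
case on: (odd n); last by rewrite an ?on// mulr0n; exact: small0.
by case: (a n); rewrite ?mulr1n ?mulr0n; [exact: small_v|exact: small0].
Qed.

Lemma subsum_limit a : exists x, forall n, odd_from n a ->
  small (E n + 2) (x - subsum v n a).
Proof.
have E_ge n : (n <= E n)%N.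
  by elim: n => // n IH; exact: leq_ltn_trans IH (E_lt n).
have [[n0 an0]|na] := pselect (exists n, odd_from n a); last first.
  by exists 0 => n an; exfalso; apply: na; exists n.
have [j|x xP] := cauchy_smallP hX (u := fun n => subsum v n a).
  exists (maxn n0 j) => n Nn; rewrite -(subnKC Nn).
  apply: small_le (small_subsum_tail _ _) => //.
    by apply: leq_trans (leq_maxr n0 j) _; apply: leq_trans (E_ge _) (leq_addr _ _).
  by move=> l Nl; apply: an0; apply: leq_trans Nl; exact: leq_maxl.
exists x => n an; have [N NP] := xP (E n + 3)%N.
rewrite -(subrK (subsum v (n + N) a) x) -addrA; apply: smallD => //.
  by rewrite -addnS; apply/(small_distC hX)/NP; exact: leq_addl.
by rewrite -addnS; exact: small_subsum_tail.
Qed.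

End cantor_scheme.

(** The set of indices summed for the point of code [c] in the [j]-th Cantor
set: the index [2 * j] once, then odd indices beyond it, chosen by [c]. The
vectors of odd rank are shared by all the Cantor sets. *)
Definition branch (j : nat) (c : nat -> bool) (l : nat) : bool :=
  (l == 2 * j)%N || [&& odd l, (2 * j < l)%N & c (l./2 - j)%N].

Lemma branch_odd_from j c n : (2 * j < n)%N -> odd_from n (branch j c).
Proof.
move=> jn l nl /negbTE ol; rewrite /branch ol /= orbF; apply/eqP; lia.
Qed.

Lemma branch_agree j n c c' : agree n c c' <->
  agree (2 * (j + n)).+1 (branch j c) (branch j c').
Proof.
split=> [cc l ln|bb i ni].
  rewrite /branch; case: (boolP (odd l)) => ol //=.
  case: (ltnP (2 * j) l) => jl //=; rewrite cc//; lia.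
have := bb (2 * (j + i)).+1; rewrite /branch.
rewrite [odd _](_ : _ = true); last lia.
rewrite [(_ == _)](_ : _ = false); last by apply/eqP; lia.
rewrite (_ : (2 * j < (2 * (j + i)).+1)%N = true); last by apply/idP; lia.
rewrite (_ : (_./2 - j)%N = i) /=; last lia.
by apply; lia.
Qed.

(** A form of Mycielski's theorem for the relation [G (x - y)]: by linearity, all
the Cantor sets can be made of subset sums of a single sequence. *)
Theorem linear_mycielski (G : set X) (O : nat -> set X) :
  comeager G -> ~ G 0 -> (forall j, open (O j) /\ O j !=set0) ->
  exists K : nat -> set X,
    (forall j, cantor_set R (K j) /\ K j `<=` O j) /\
    forall x y, (\bigcup_j K j) x -> (\bigcup_j K j) y -> x <> y -> G (x - y).
Proof.
move=> [U UP UG] G0 OP.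
have [|v [E [E_lt small_v vO vU]]] := generic_sequence UP _ OP; first by move/UG.
have [L LP] := choice (subsum_limit E_lt small_v).
have E_ge n : (n <= E n)%N.
  by elim: n => // n IH; exact: leq_ltn_trans IH (E_lt n).
have diff a b n : odd_from n a -> odd_from n b ->
    small (E n).+1 ((L a - L b) - (subsum v n a - subsum v n b)).
  move=> an bn; rewrite opprD addrACA -opprD.
  by apply: smallB => //; rewrite -addn2; exact: LP.
exists (fun j => range (fun c => L (branch j c))); split.
  move=> j; split.
    apply: (cantor_set_range hX) => [q|n].
      exists q => c c' /(branch_agree j) cc.
      have := @diff (branch j c) (branch j c') (2 * (j + q)).+1.
      rewrite (subsum_agree _ cc) subrr subr0 => h.
      apply: small_le (h _ _) => //; [|apply: branch_odd_from; lia..].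
      have := E_ge (2 * (j + q)).+1; lia.
    exists (E (2 * (j + n)).+1).+1 => c c' scc; apply/(branch_agree j).
    apply: contrapT => /vU[+ _]; apply.
    have := @diff (branch j c) (branch j c') (2 * (j + n)).+1.
    move=> /(_ _ _)/(smallB hX scc); rewrite subKr; apply; apply: branch_odd_from; lia.
  move=> _ [c _ <-]; apply: vO.
  have := LP (branch j c) (2 * j).+1 (branch_odd_from _ (ltnSn _)).
  rewrite subsumS /subsum big1 => [|l _]; last first.
    rewrite /branch (ltn_eqF (ltn_ord l)) ltnNge (ltnW (ltn_ord l)) /= andbF.
    by rewrite mulr0n.
  rewrite add0r /branch eqxx mulr1n; apply: small_le => //; exact: leq_addr.
move=> _ _ [i _ [c _ <-]] [j _ [c' _ <-]] xy.
apply: UG => q _.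
have [n nab] : exists n, ~ agree n (branch i c) (branch j c').
  apply: contrapT => /forallNP h; apply: xy; congr L; apply/funext => l.
  by have /contrapT/(_ l (ltnSn l)) := h l.+1.
(* from rank [N] on the two codes have separated, [U q] is controlled, and only
   small vectors remain *)
pose N := maxn n (q + (2 * (i + j)).+1).
have [|_ /(_ q _)] := vU N (branch i c) (branch j c').
  move=> h; apply: nab => l ln; apply: h; rewrite /N; lia.
apply; first by rewrite /N; lia.
apply: small_le (diff _ _ N _ _) => //; apply: branch_odd_from; rewrite /N; lia.
Qed.

End mycielski.

(** * Orbits of a continuous linear operator *)

Lemma misses_sum (A : set nat) n :
  misses A n = (\sum_(i <- iota 1 n) (i \notin A))%N.
Proof. by rewrite /misses -sum1_count big_mkcond. Qed.

(** Double counting: at a time in [Z] at most one of the sets [A t] is missed,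
at another time possibly all [L] of them. *)
Lemma sum_misses_le (L n : nat) (A : nat -> set nat) (Z : set nat) :
  (forall i t t', Z i -> ~ A t i -> ~ A t' i -> t = t') ->
  (\sum_(t < L) misses (A t) n <= L * misses Z n + n)%N.
Proof.
move=> uniqA; under eq_bigr do rewrite misses_sum.
rewrite exchange_big /= misses_sum big_distrr /=.
rewrite -[X in (_ <= _ + X)%N](size_iota 1 n) -sum1_size -big_split /=.
apply: leq_sum => i _; case: (boolP (i \in Z)) => iZ /=.
  rewrite muln0 add0n -big_mkcond /= sum1_card; apply/card_le1_eqP => t t'.
  rewrite !unfold_in /= => /negP; rewrite inE => At /negP; rewrite inE => At'.
  by apply: val_inj; move: iZ; rewrite inE => /uniqA; apply.
rewrite muln1; apply: leq_trans (leq_addr _ _).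
by rewrite -[leqRHS]card_ord -sum1_card leq_sum// => t _; case: (_ \in _).
Qed.

(** Only finitely many times are involved, and the condition at each of them is
open. *)
Lemma open_misses_lt (X : topologicalType) (phi : nat -> set X) k n :
  (forall i, open (phi i)) ->
  open [set x | (k * misses [set i | phi i x] n < n)%N].
Proof.
move=> ophi; rewrite openE => x /= kx.
suff : \forall y \near x, forall i, (0 < i <= n)%N -> phi i x -> phi i y.
  apply: filterS => y xy /=; apply: leq_ltn_trans kx.
  by rewrite leq_mul// misses_mono.
elim: {kx} n => [|n IH]; first by apply: nearW => y i; lia.
have [phix|nphix] := pselect (phi n.+1 x).
  have : nbhs x (phi n.+1) by exact: open_nbhs_nbhs.
  apply: filterS2 IH => y IH phiy i ri; have [->//|ni] := eqVneq i n.+1.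
  by apply: IH; lia.
apply: filterS IH => y IH i ri; have [->//|ni] := eqVneq i n.+1.
by apply: IH; lia.
Qed.

Lemma comeager_full (X : topologicalType) (phi : nat -> set X) :
  (forall i, open (phi i)) ->
  (forall k N, dense [set x | exists2 n, (N <= n)%N &
     (k * misses [set i | phi i x] n < n)%N]) ->
  comeager [set x | full [set i | phi i x]].
Proof.
move=> ophi dphi.
pose W k N := [set x | exists2 n, (N <= n)%N &
  (k * misses [set i | phi i x] n < n)%N].
have : comeager (\bigcap_k \bigcap_N W k N).
  apply: comeager_bigcap => k; apply: comeager_bigcap => N.
  exists (fun=> W k N); last by move=> x /(_ 0%N I).
  move=> _; split; last exact: dphi.
  rewrite (_ : W k N = \bigcup_(n in [set n | (N <= n)%N])
      [set x | (k * misses [set i | phi i x] n < n)%N]) //.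
  by apply: bigcup_open => n _; exact: open_misses_lt.
by apply: comeagerS => x Wx k N; exact: Wx.
Qed.

Lemma full_near (A P : set nat) :
  full A -> (\forall n \near within A \oo, P n) -> full P.
Proof.
move=> /full_from fA [N _ NP]; apply: fullS (fA N) => n /= [An Nn].
exact: NP.
Qed.

Section dynamics.
Context {R : realType} {k : scalar_kind} {X : tvsType (scalar_field R k)}.
Variables (p : nat -> X -> R) (T : {linear X -> X}).
Hypothesis hX : frechet p.
Hypothesis hT : continuous T.
Local Notation small := (dyadic_small p).
Local Notation d := (seminorm_dist p).

Lemma iter_raddfB n x y : iter n T (x - y) = iter n T x - iter n T y.
Proof. by elim: n => //= n ->; rewrite raddfB. Qed.

Lemma iter_raddfMn n x c : iter n T (x *+ c) = iter n T x *+ c.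
Proof. by elim: n => //= n ->; rewrite raddfMn. Qed.

Lemma iter_raddf0 n : iter n T 0 = 0.
Proof. by elim: n => //= n ->; rewrite raddf0. Qed.

Lemma continuous_iter n : continuous (iter n T).
Proof.
elim: n => [|n IH] x /=; first exact: cvg_id.
exact: cvg_comp (IH x) (@hT (iter n T x)).
Qed.

Definition null_orbit (x : X) : Prop :=
  forall j, full [set n | small j (iter n T x)].

Definition unbounded_orbit (m : nat) (x : X) : Prop :=
  forall M : R, full [set n | M < p m (iter n T x)].

(** What remains of sensitivity for a linear map: one seminorm and one bound
serve for points arbitrarily close to the origin. *)
Definition expanding_at_zero (m : nat) : Prop :=
  exists2 eta : R, 0 < eta & forall j, exists2 z, small j z &
    full [set n | eta < p m (iter n T z)].

Lemma comeager_null_orbit : dense null_orbit -> comeager null_orbit.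
Proof.
move=> dnull.
apply: comeagerS (comeager_bigcap
    (S := fun j => [set x | full [set n | small j (iter n T x)]]) _).
  by move=> x nx j; exact: nx.
move=> j; apply: comeager_full => [n|l N].
  apply: (open_comp (f := iter n T) (D := [set x | small j x])).
    by move=> x _; exact: continuous_iter.
  exact: (open_p_lt hX).
by apply: denseS dnull => x nx; exact: nx.
Qed.

Lemma expanding_scale m (M : R) : expanding_at_zero m ->
  forall j, exists2 z, small j z & full [set n | M < p m (iter n T z)].
Proof.
move=> [eta eta0 ez] j; pose c := (Num.truncn (M / eta)).+1.
have cM : M < c%:R * eta by rewrite -ltr_pdivrMr// truncnS_gt.
have [i ic] : exists i, 2^-1 ^+ i < 2^-1 ^+ j / c%:R :> R.
  by apply: exp2V_lt; rewrite divr_gt0 ?exp2V_gt0 ?ltr0n.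
have [z sz fz] := ez (maxn i j); exists (z *+ c).
  rewrite /dyadic_small seminormMn// mulrC -ltr_pdivlMr ?ltr0n//.
  apply: le_lt_trans (frechet_increasing hX _ (leq_maxr i j)) _.
  by apply: lt_trans sz (le_lt_trans _ ic); rewrite exp2V_le// leq_maxl.
apply: fullS fz => n /= h.
rewrite iter_raddfMn seminormMn//; apply: lt_trans cM _.
by rewrite ltr_pM2l ?ltr0n.
Qed.

(** To find a good point near [x], try [x + t z] for [t < 2 l + 1]: two of them
differ by a multiple of [z], so at a time when [p m (T^n z)] exceeds [2 c] they
cannot both stay below [c]. On average over [t], the proportion of bad times is
then about [1 / (2 l + 1)], and some [t] does at least as well. *)
Lemma comeager_unbounded_orbit m :
  expanding_at_zero m -> comeager (unbounded_orbit m).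
Proof.
move=> em.
apply: comeagerS (comeager_bigcap
    (S := fun c => [set x | full [set n | c%:R < p m (iter n T x)]]) _).
  move=> x ux M; apply: fullS (ux (Num.truncn M).+1 I) => n /=.
  by apply: lt_trans; exact: truncnS_gt.
move=> c; apply: comeager_full => [n|l N].
  apply: (open_comp (f := iter n T) (D := [set x | c%:R < p m x])).
    by move=> x _; exact: continuous_iter.
  exact: (open_p_gt hX).
apply/(dense_smallP hX) => x j; pose L := (2 * l).+1.
have [i iL] : exists i, 2^-1 ^+ i < 2^-1 ^+ j / L%:R :> R.
  by apply: exp2V_lt; rewrite divr_gt0 ?exp2V_gt0 ?ltr0n.
have [z sz fz] := expanding_scale (2 * c%:R) em (maxn i j).
have [n Nn ln] := fz (2 * l)%N N.
pose A t := [set i | c%:R < p m (iter i T (x + z *+ t))].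
(* pigeonhole: otherwise the sum of all the misses would be too large *)
have [t tL At] : exists2 t, (t < L)%N & (l * misses (A t) n < n)%N.
  apply: contrapT => nA.
  have h2 : (L * n <= l * \sum_(t < L) misses (A t) n)%N.
    rewrite big_distrr /= -[X in (X * n)%N]card_ord -sum_nat_const leq_sum// => t _.
    rewrite leqNgt; apply/negP => lt; apply: nA; exists (val t) => //; exact: ltn_ord.
  have h1 : (\sum_(t < L) misses (A t) n <=
      L * misses [set i | 2 * c%:R < p m (iter i T z)]%R n + n)%N.
    apply: sum_misses_le.
    move=> q t t' /= zq; wlog tt : t t' / (t < t')%N => [wl At At'|].
      have [tt|tt|//] := ltngtP t t'; first exact: wl.
      by apply/esym/wl.
    move=> /negP; rewrite -leNgt => At /negP; rewrite -leNgt => At'; exfalso.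
    have := seminormB hX m (iter q T (x + z *+ t')) (iter q T (x + z *+ t)).
    rewrite -iter_raddfB opprD addrACA subrr add0r -mulrnBr 1?ltnW// iter_raddfMn seminormMn//.
    have : p m (iter q T z) <= (t' - t)%:R * p m (iter q T z).
      by rewrite ler_peMl ?seminorm_ge0// ler1n subn_gt0.
    move=> le1 /(le_trans le1); move: zq At At' => /=; lra.
  have h3 := leq_trans h2 (leq_mul (leqnn l) h1).
  have h4 := leq_mul (leqnn L) (ltnW ln); have n0 := leq_ltn_trans (leq0n _) ln.
  move: n0 h3 h4; rewrite /L; move: (misses _ n); clear; nia.
exists (x + z *+ t); last by exists n.
rewrite addrC addKr /dyadic_small seminormMn// mulrC.
have [->|t0] := eqVneq t 0%N; first by rewrite mulr0 exp2V_gt0.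
have t0' : 0 < t%:R :> R by rewrite ltr0n lt0n.
rewrite -ltr_pdivlMr//; apply: le_lt_trans (frechet_increasing hX _ (leq_maxr i j)) _.
apply: lt_trans sz (le_lt_trans _ (lt_le_trans iL _)).
  by rewrite exp2V_le// leq_maxl.
by rewrite ler_wpM2l ?exprn_ge0// lef_pV2 ?posrE ?ltr0n ?lt0n// ler_nat ltnW.
Qed.

(** The sets of times given by the different radii decrease, so they can be
merged into one along which the orbit converges. *)
Lemma null_orbitP x : null_orbit x <->
  exists2 A : set nat, upper_density R A = 1%E &
     iter n T x @[n --> within A \oo] --> (0 : X).
Proof.
split=> [nx|[A /fullP fA] /(cvg0_smallP hX) Ax j]; last exact: full_near (Ax j).
have [|B fB BP] := @full_diagonal (fun j => [set n | small j (iter n T x)]) _ nx.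
  by move=> j n /=; exact: small_le.
exists B; first exact/fullP.
apply/(cvg0_smallP hX) => j; have [N NP] := BP j.
by exists N => // n /= Nn Bn; exact: NP.
Qed.

Lemma unbounded_orbitP m x : unbounded_orbit m x <->
  exists2 B : set nat, upper_density R B = 1%E &
     p m (iter n T x) @[n --> within B \oo] --> +oo.
Proof.
split=> [ux|[B /fullP fB] /cvgryPgt Bx M]; last exact: full_near (Bx M).
have [||B fB BP] := @full_diagonal (fun j => [set n | j%:R < p m (iter n T x)]).
- by move=> j n /=; apply: lt_trans; rewrite ltr_nat.
- by move=> j; exact: ux.
exists B; first exact/fullP.
apply/cvgryPgt => M; have [N NP] := BP (Num.truncn M).+1; exists N => // n /= Nn Bn.
by apply: lt_trans (NP n Nn Bn); exact: truncnS_gt.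
Qed.

Lemma irregularP m x :
  distr_irregular1 p T m x <-> null_orbit x /\ unbounded_orbit m x.
Proof. by rewrite /distr_irregular1 -null_orbitP -unbounded_orbitP. Qed.

Lemma proximalP x y : distr_proximal p T (x, y) <-> null_orbit (x - y).
Proof.
split=> [pxy j|nxy e e0].
  have [e e0 ej] := dist_small hX j.
  have /fullP := pxy e e0; apply: fullS => n /= /ej.
  by rewrite iter_raddfB.
have [j je] := small_dist hX e0.
by apply/fullP; apply: fullS (nxy j) => n /=; rewrite iter_raddfB; exact: je.
Qed.

Lemma extremely_chaoticP m x y : distr_extremely_chaotic1 p T m (x, y) <->
  null_orbit (x - y) /\ unbounded_orbit m (x - y).
Proof.
rewrite /distr_extremely_chaotic1 /= proximalP; split => -[nxy uxy]; split => // M.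
  have M0 : 0 < Num.max 1 M by rewrite lt_max ltr01.
  have /fullP := uxy _ M0; apply: fullS => n /=.
  by rewrite iter_raddfB; apply: le_lt_trans; rewrite le_max lexx orbT.
by move=> _; apply/fullP; apply: fullS (uxy M) => n /=; rewrite iter_raddfB.
Qed.

Lemma dist_away (delta : R) : 0 < delta -> exists m, exists2 eta : R, 0 < eta &
  forall x y, delta < d x y -> eta < p m (x - y).
Proof.
move=> /(small_dist hX)[m md]; exists m, (2^-1 ^+ m.+1); first exact: exp2V_gt0.
move=> x y; apply: contraPP => /negP; rewrite -leNgt => xy; apply/negP.
rewrite -leNgt; apply/ltW/md; apply: le_lt_trans xy _.
by rewrite -[ltRHS]exp2VS ltrDl exp2V_gt0.
Qed.

(** Small vectors are found on the orbit of [x] itself: [T^a x] is small for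
suitable [a], and its orbit is a shift of that of [x]. *)
Lemma semi_irregular_expanding x : distr_semi_irregular1 p T x ->
  exists m, expanding_at_zero m.
Proof.
move=> [/null_orbitP nx [B /fullP fB]].
rewrite limf_einfE => /ereal_sup_gt[_ [V BV <-]] V0.
have [c c0 Vc] : exists2 c : R, 0 < c & forall n, V n -> c < d (iter n T x) 0.
  have [c c0 cV] : exists2 c : R, 0 < c &
      (c%:E < ereal_inf ((fun n => (d (iter n T x) 0)%:E) @` V))%E.
    case: (ereal_inf _) V0 => [r| |//] r0; last by exists 1; rewrite // ltry.
    by exists (r / 2); rewrite ?lte_fin; move: r0; rewrite lte_fin; lra.
  exists c => // n Vn; rewrite -lte_fin; apply: lt_le_trans cV _.
  by apply: ereal_inf_lbound; exists n.
have [m [eta eta0 ceta]] := dist_away c0; exists m, eta => // j.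
have [a /= ja _] := full_unbounded 0 (nx j); exists (iter a T x) => //.
have : full V by exact: full_near fB BV.
move=> /(full_shift a); apply: fullS => n /= Vn.
by rewrite -iterD -[iter _ _ _]subr0; apply/ceta/Vc.
Qed.

Lemma irregular_semi m x :
  distr_irregular1 p T m x -> distr_semi_irregular1 p T x.
Proof.
move=> [Ax [B dB Bx]]; split=> //; exists B => //.
pose c : R := 2^-1 ^+ m.+1.
apply: (@lt_le_trans _ _ c%:E); first by rewrite lte_fin exp2V_gt0.
rewrite limf_einfE; apply: le_ereal_sup_tmp.
exists (ereal_inf ((fun n => (d (iter n T x) 0)%:E) @`
   [set n | 1 < p m (iter n T x)])).
  exists [set n | 1 < p m (iter n T x)] => //.
  by move/cvgryPgt : Bx; exact.
apply: le_ereal_inf_tmp => _ [n /= n1 <-]; rewrite lee_fin.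
apply: le_trans (dist_ge hX m _ _); rewrite subr0 (min_idPl (ltW n1)).
by rewrite mulr1.
Qed.

Lemma comeager_irregular m :
  dense null_orbit -> expanding_at_zero m -> comeager (distr_irregular1 p T m).
Proof.
move=> dn em; apply: comeagerS (comeagerI (comeager_null_orbit dn)
  (comeager_unbounded_orbit em)) => x [nx ux].
exact/irregularP.
Qed.

(** If [(y, z)] is proximal and close to [(x, 0)], then [y - z] has a null orbit
and is close to [x]. *)
Lemma dense_proximal_null : dense (distr_proximal p T) -> dense null_orbit.
Proof.
move=> dP; apply/(dense_smallP hX) => x j.
have [||[y z] [[/= yx z0] /proximalP nyz]] :=
  dP (fst @^-1` [set y | small j.+1 (y - x)]° `&`
    snd @^-1` [set y | small j.+1 y]).
- exists (x, 0); split => /=; last exact: small0.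
  by apply/(nbhs_smallP hX); exists j.+1.
- apply: openI; apply: open_comp => //.
  + by move=> ? _; exact: cvg_fst.
  + exact: open_interior.
  + by move=> ? _; exact: cvg_snd.
  + exact: (open_p_lt hX).
exists (y - z) => //; rewrite addrAC; apply: smallB => //.
exact: interior_subset yx.
Qed.

Lemma sensitive_expanding : distr_sensitive p T -> exists m, expanding_at_zero m.
Proof.
move=> [delta /dist_away[m [eta eta0 meta]] sens]; exists m, eta => // j.
have [e e0 ej] := dist_small hX j.
have [y /ej] := sens 0 e e0; rewrite sub0r => /(smallN hX) sy /fullP fy.
exists y => //; apply: fullS fy => n /= /meta.
by rewrite iter_raddf0 sub0r seminormN.
Qed.

End dynamics.

Theorem theorem5p35 (R : realType) (k : scalar_kind)
    (X : tvsType (scalar_field R k)) (p : nat -> X -> R) (T : {linear X -> X})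
    (hX : frechet p) (hdim : infinite_dimensional X) (hT : continuous T) :
  [<-> dense [set x | distr_semi_irregular1 p T x];
       exists m : nat, residual [set x | distr_irregular1 p T m x];
       exists m : nat, forall O : nat -> set X,
         (forall j, open (O j) /\ O j !=set0) ->
         exists K : nat -> set X,
           (forall j, cantor_set R (K j) /\ K j `<=` O j) /\
           distr_extremely_scrambled1 p T m (\bigcup_j K j);
       dense (distr_proximal p T) /\ distr_sensitive p T].
Proof.
tfae.
- move=> dS.
  have [x [_ /(semi_irregular_expanding hX)[m em]]] :=
    dS setT (ex_intro _ 0 I) openT.
  exists m; apply/(residualP hX); apply: (comeager_irregular hX hT) => //.
  by apply: denseS dS => y [/(null_orbitP T hX)].
- move=> [m /(residualP hX) cS]; exists m => O OP.
  have [|K [KO Kdiff]] := linear_mycielski hX cS _ OP.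
    move=> /(irregularP T hX)[_ /(_ 0)/(full_unbounded 0)[n /=]].
    by rewrite iter_raddf0 (seminorm0 hX) ltxx.
  exists K; split=> // x y Kx Ky xy; apply/(extremely_chaoticP T hX).
  by apply/(irregularP T hX)/Kdiff.
- move=> [m scrambled]; split.
    move=> W [[x y] Wxy] oW.
    have [[A B] /= [Ax By] ABW] : nbhs (x, y) W by exact: open_nbhs_nbhs.
    (* two scrambled points, one in each factor, form a proximal pair *)
    pose O j := if j is 0%N then A° else B°.
    have [|K [KO chaotic]] := scrambled O.
      case=> [|j]; split; [exact: open_interior|by exists x|exact: open_interior|].
      by exists y.
    have [a [_ [Ka _ _]]] := cantor_set_two_points (KO 0%N).1.
    have [b [_ [Kb _ _]]] := cantor_set_two_points (KO 1%N).1.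
    exists (a, b); split.
      by apply: ABW; split; apply: interior_subset;
        [exact: (KO 0%N).2|exact: (KO 1%N).2].
    have [->|ab] := pselect (a = b).
      apply/(proximalP T hX) => j; apply: fullS full_setT => n _ /=.
      by rewrite subrr iter_raddf0; exact: small0.
    by have [] := chaotic a b (ex_intro2 _ _ 0%N I Ka) (ex_intro2 _ _ 1%N I Kb) ab.
  (* [p m > 1] forces a distance of at least [2^-(m+1)] *)
  exists (2^-1 ^+ m.+2) => [|x e /(small_dist hX)[j je]]; first exact: exp2V_gt0.
  have [|K [KO chaotic]] := scrambled (fun=> [set z | dyadic_small p j.+1 z]).
    by split; [exact: (open_p_lt hX)|exists 0; exact: small0].
  have [u [v [Ku Kv uv]]] := cantor_set_two_points (KO 0%N).1.
  have [_ /(_ 1 ltr01)] := chaotic u v (ex_intro2 _ _ 0%N I Ku) (ex_intro2 _ _ 0%N I Kv) uv.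
  move=> /fullP fuv; exists (x - (u - v)).
    apply: je; rewrite subKr; apply: smallB => //; exact: (KO 0%N).2.
  apply/fullP; apply: fullS fuv => n /= n1.
  apply: lt_le_trans (dist_ge hX m _ _); rewrite -iter_raddfB subKr.
  rewrite iter_raddfB (min_idPl (ltW n1)) mulr1 -[ltRHS]exp2VS ltrDl exp2V_gt0//.
- move=> [dP sens]; have [m em] := sensitive_expanding hX sens.
  have cS := comeager_irregular hX hT (dense_proximal_null hX dP) em.
  by apply: denseS (comeager_dense hX cS) => x; exact: irregular_semi.
Qed.
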